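(* Assume the following. (1) There exist $\alpha_x,\alpha_u\in\mathcal{K}_\infty$ such that for all $\theta\in\Theta$, $x,x'\in X$, $u,u'\in U$: $d_X(f(x,u,\theta),f(x',u',\theta))\le \alpha_x(d_X(x,x'))+\alpha_u(d_U(u,u'))$. (2) (i) There exist $\gamma_x,\gamma_u\in\mathcal{K}_\infty$ such that $|\ell_0(x,u,\theta)-\ell_0(x',u',\theta)|\le\gamma_x(d_X(x,x'))+\gamma_u(d_U(u,u'))$ for all $x,x'\in X$, $u,u'\in U$, $\theta\in\Theta$; (ii) $\ell_u$ is lower semicontinuous; (iii) there exists $\gamma_N\in\mathcal{K}_\infty$ such that $|F_N(x,\theta)-F_N(x',\theta)|\le\gamma_N(d_X(x,x'))$ for all $x,x'\in X$, $\theta\in\Theta$. (3) For all $u\in U$, $\ell_0(\cdot,u,\cdot)$ is $\mathcal{B}(X)\times\mathcal{B}(\Theta)$-$\mathcal{B}(\mathbb{R}_{\ge0})$ measurable and $f(\cdot,u,\cdot)$ is $\mathcal{B}(X)\times\mathcal{B}(\Theta)$-$\mathcal{B}(X)$ measurable, and $F_N$ is $\mathcal{B}(X)\times\mathcal{B}(\Theta)$-$\mathcal{B}(\mathbb{R}_{\ge0})$ measurable. (4) There exists a coercive function $r\colon U\to\mathbb{R}_{\ge0}$ such that $\ell(x,u,\theta)\ge r(u)$ for all $x\in X$, $u\in U$, $\theta\in\Theta$. Then for all $\mu\in\mathcal{P}(\Theta)$ and all measurable $\bar x_0\colon\Theta\to X$, the map $U^N\ni\underline{u}\mapsto\bar J_N(\bar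 x_0,\underline{u},\mu)$ is well-defined and there exists $\underline{u}^\ast\in U^N$ with $$\bar J_N(\bar x_0,\underline{u}^\ast,\mu)=\bar V_N(\bar x_0,\mu)=\min_{\underline{u}\in U^N}\bar J_N(\bar x_0,\underline{u},\mu).$$
   Context: $(X,d_X)$, $(U,d_U)$, $(\Theta,d_\Theta)$ are (nonempty) metric spaces with Borel $\sigma$-algebras $\mathcal{B}(X),\mathcal{B}(U),\mathcal{B}(\Theta)$; $\mathcal{P}(\Theta)$ is the set of Borel probability measures on $\Theta$; $N\ge1$ is an integer. $\mathcal{B}(X)\times\mathcal{B}(\Theta)$ denotes the product $\sigma$-algebra. $f\colon X\times U\times\Theta\to X$ is a transition function. The stage cost $\ell\colon X\times U\times\Theta\to\mathbb{R}_{\ge0}$ has the form $\ell(x,u,\theta)=\ell_u(u)+\ell_0(x,u,\theta)$ with $\ell_u\colon U\to\mathbb{R}_{\ge0}$, $\ell_0\colon X\times U\times\Theta\to\mathbb{R}_{\ge0}$; the terminal cost is $F_N\colon X\times\Theta\to\mathbb{R}_{\ge0}$. For $x_0\in X$, $\theta\in\Theta$ and $\underline{u}=(\underline{u}(0),\dots,\underline{u}(N-1))\in U^N$, the trajectory is defined by $\phi_{\underline{u},x_0}^\theta(0)=x_0$, $\phi_{\underline{u},x_0}^\theta(n+1)=f(\phi_{\underline{u},x_0}^\theta(n),\underline{u}(n),\theta)$ for $0\le n<N$. The total cost is $$J_N(x_0,\underline{u},\theta)=\sum_{n=0}^{N-1}\ell(\phi_{\underline{u},x_0}^\theta(n),\underline{u}(n),\theta)+F_N(\phi_{\underline{u},x_0}^\theta(N),\theta).$$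 For $\bar x_0\colon\Theta\to X$ and $\mu\in\mathcal{P}(\Theta)$, the averaged cost is $\bar J_N(\bar x_0,\underline{u},\mu)=\int_\Theta J_N(\bar x_0(\theta),\underline{u},\theta)\,\mathrm{d}\mu(\theta)$, with values in $\mathbb{R}_{\ge0}\cup\{\infty\}$ (''well-defined'' means that the integrand is measurable, so that the integral makes sense), and $\bar V_N(\bar x_0,\mu)=\inf_{\underline{u}\in U^N}\bar J_N(\bar x_0,\underline{u},\mu)$. $\mathcal{K}_\infty$ is the set of continuous, strictly increasing $\alpha\colon\mathbb{R}_{\ge0}\to\mathbb{R}_{\ge0}$ with $\alpha(0)=0$ and $\lim_{r\to\infty}\alpha(r)=\infty$. A function $g\colon Z\to\mathbb{R}\cup\{\infty\}$ on a metric space is lower semicontinuous if $g(z)\le\liminf_k g(z_k)$ whenever $z_k\to z$; it is coercive if for all $t\in\mathbb{R}$ the set $\{z\in Z\mid g(z)<t\}$ is precompact, i.e. has compact closure in $Z$. *)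

(* Defs.v *)
From HB Require Import structures.
From mathcomp Require Import all_boot all_order all_algebra.
From mathcomp Require Import all_classical all_reals all_analysis.

Set Implicit Arguments.
Unset Strict Implicit.
Unset Printing Implicit Defensive.

Import Order.TTheory GRing.Theory Num.Theory.
Import numFieldNormedType.Exports.

Local Open Scope classical_set_scope.
Local Open Scope ring_scope.

(* Nonempty metric spaces: the base point only witnesses nonemptiness, which
   the measurable structures of the library require of their carrier. *)
#[short(type="pmetricType")]
HB.structure Definition PMetric (K : numDomainType) :=
  { M of Pointed M & Metric K M }.

Notation borel T := (g_sigma_algebraType (@open T)).

Section preliminaries.
Context {R : realType}.

(* A map of [0, +oo[ into itself is represented by a total map R -> R, whose
   values at negative arguments are irrelevant. *)
Definition class_Kinfty (a : R -> R) : Prop :=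
  [/\ forall r, 0 <= r -> 0 <= a r,
      {within `[0, +oo[, continuous a},
      {in `[0, +oo[ &, {homo a : r s / r < s}},
      a 0 = 0 &
      a r @[r --> +oo] --> +oo].

Definition coercive {Z : topologicalType} (g : Z -> \bar R) : Prop :=
  forall t : R, precompact [set z | (g z < t%:E)%E].

Lemma coerciveE {Z : topologicalType} (g : Z -> \bar R) :
  coercive g <-> forall t : R, compact (closure [set z | (g z < t%:E)%E]).
Proof. by split=> h t; move: (h t); rewrite precompactE. Qed.

Lemma lower_semicontinuous_seqP {Z : metricType R} (g : Z -> \bar R) :
  lower_semicontinuous g <->
  forall (z : Z) (zk : nat -> Z), zk @ \oo --> z ->
    (g z <= limn_einf (g \o zk))%E.
Proof.
split=> [lsc z zk zkz|H x a agx].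
- rewrite leNgt; apply/negP => lim_lt.
  have [b /andP[lim_b b_gz]] :
      exists b : R, (limn_einf (g \o zk) < b%:E < g z)%E.
    move: lim_lt; move: (limn_einf _) (g z) => [r| |] [s| |]//=.
    - rewrite lte_fin => rs; exists ((r + s) / 2).
      by rewrite !lte_fin !midf_lt.
    - by exists (r + 1); rewrite lte_fin ltrDl ltr01 ltry.
    - by exists (s - 1); rewrite ltNyr lte_fin ltrBlDr ltrDl ltr01.
    - by exists 0; rewrite ltNyr ltry.
  have [V nV Vb] := lsc _ _ b_gz.
  have [n _ nP] : \forall k \near \oo, V (zk k) by exact: zkz.
  move: lim_b; rewrite ltNge => /negP; apply.
  rewrite limn_einf_lim; apply: lime_ge; first exact: is_cvg_einfs.
  exists n => // m /= nm; apply: le_ereal_inf_tmp => _ [k /= mk <-].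
  by apply/ltW/Vb/nP => /=; apply: leq_trans mk.
- apply: contrapT => noV.
  have /choice[y yP] : forall n : nat,
      exists y, ball x n.+1%:R^-1 y /\ (g y <= a%:E)%E.
    move=> n; apply: contrapT => no; apply: noV.
    exists (ball x n.+1%:R^-1); first by apply: nbhsx_ballx; rewrite invr_gt0.
    by move=> y xy; rewrite ltNge; apply/negP => gya; apply: no; exists y.
  have yx : y @ \oo --> x.
    apply/cvg_ballP => e e0; near=> n.
    apply: le_ball (yP n).1; apply/ltW; near: n.
    exact: near_infty_natSinv_lt (PosNum e0).
  have := H _ _ yx; apply/negP; rewrite -ltNge; apply: le_lt_trans agx.
  rewrite limn_einf_lim; apply: lime_le; first exact: is_cvg_einfs.
  near=> n; apply: le_trans (yP n).2; apply: ereal_inf_lbound.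
  by exists n => /=.
Unshelve. all: by end_near. Qed.

End preliminaries.

Section control_problem.
Context {R : realType} {X U Theta : pmetricType R} {N : nat}.
Variables (f : X -> U -> Theta -> X) (l : X -> U -> Theta -> R)
          (FN : X -> Theta -> R).

(* Control sequences are indexed by 'I_N; the trajectory is only meaningful up
   to time N, and is arbitrarily continued by a constant. *)
Fixpoint traj (u : 'I_N -> U) (x0 : X) (theta : Theta) (n : nat) : X :=
  if n is m.+1 then
    if insub m is Some i then f (traj u x0 theta m) (u i) theta
    else traj u x0 theta m
  else x0.

Lemma trajS u x0 theta (i : 'I_N) :
  traj u x0 theta i.+1 = f (traj u x0 theta i) (u i) theta.
Proof. by rewrite /= valK. Qed.

Definition total_cost (x0 : X) (u : 'I_N -> U) (theta : Theta) : R :=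
  \sum_(n < N) l (traj u x0 theta n) (u n) theta + FN (traj u x0 theta N) theta.

Definition averaged_cost (xbar0 : Theta -> X) (u : 'I_N -> U)
    (mu : probability (borel Theta) R) : \bar R :=
  (\int[mu]_theta (total_cost (xbar0 theta) u theta)%:E)%E.

Definition value_function (xbar0 : Theta -> X)
    (mu : probability (borel Theta) R) : \bar R :=
  ereal_inf [set averaged_cost xbar0 u mu | u in [set: 'I_N -> U]].

End control_problem.

Arguments value_function {R X U Theta} N f l FN xbar0 mu.

(* Main.v *)
(* The moduli of continuity do not depend on theta, so if u' is close to u in
   U^N then J_N(x0, u, theta) <= J_N(x0, u', theta) + e for all x0 and theta at
   once. Integrating, the averaged cost is lower semicontinuous without recourse
   to Fatou's lemma. Since mu has mass 1, a bound t on the averaged cost bounds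
   each r(u(n)) by t, so sublevel sets lie in a product of compact sets, and a
   cluster point of the filter of sublevel sets above the infimum is optimal. *)
Require Import Defs.
From HB Require Import structures.
From mathcomp Require Import all_boot all_order all_algebra.
From mathcomp Require Import all_classical all_reals all_analysis.
From mathcomp Require Import measurable_realfun lra.

Set Implicit Arguments.
Unset Strict Implicit.
Unset Printing Implicit Defensive.

Import Order.TTheory GRing.Theory Num.Theory.
Import numFieldNormedType.Exports.

Local Open Scope classical_set_scope.
Local Open Scope ring_scope.

(** Continuity from the right at 0 gives some [d > 0] with [a d < e], and monotonicity extends the
    bound to all of [[0, d)]. *)
Lemma class_Kinfty_small {R : realType} (a : R -> R) : class_Kinfty a ->
  forall e, 0 < e -> exists2 d, 0 < d & forall r, 0 <= r -> r < d -> a r < e.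
Proof.
move=> [_ /continuous_within_itvcyP[_ a_cont] a_homo a0 _] e e0.
near (0%R : R)^'+ => d.
have d0 : 0 < d by near: d; exact: nbhs_right_gt.
exists d => // r r0 rd.
have : a r < a d.
  by apply: a_homo => //; rewrite in_itv/= andbT// ltW.
move=> /lt_trans; apply; rewrite -[ltLHS]subr0 -a0.
apply: le_lt_trans (ler_norm _) _; rewrite distrC.
by near: d; move/cvgrPdist_lt : a_cont; exact.
Unshelve. all: by end_near. Qed.

(** The direct method, with filters in place of minimizing sequences. Semicontinuity is stated
    additively, a form that passes through integrals; where [J x = +oo] it forces [J] to be infinite
    near [x]. *)
Lemma lower_semicontinuous_min {R : realType} {T : topologicalType} (x0 : T)
    (J : T -> \bar R) : (forall x, 0 <= J x)%E ->
  (forall x (e : R), 0 < e -> \forall y \near x, (J x <= J y + e%:E)%E) ->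
  (forall t : R, exists2 K, compact K & [set x | (J x <= t%:E)%E] `<=` K) ->
  exists x, forall y, (J x <= J y)%E.
Proof.
move=> J0 J_lsc J_coercive.
(* If [J] is identically [+oo], then [x0] is a minimizer; otherwise the infimum [m] is finite and
   the levels [m + e] lie strictly above it. *)
have [J_oo|/existsNP[x1 /eqP]] := pselect (forall x, J x = +oo%E).
  by exists x0 => y; rewrite !J_oo.
rewrite -ltey => x1_oo.
pose m := ereal_inf (range J).
have m_fin : m \is a fin_num.
  rewrite ge0_fin_numE; last by apply: le_ereal_inf_tmp => _ [x _ <-].
  by apply: le_lt_trans x1_oo; apply: ereal_inf_lbound; exists x1.
pose S (e : R) := [set x | (J x <= m + e%:E)%E].
have S_sub e e' : e <= e' -> S e `<=` S e'.
  by move=> ee' x /le_trans; apply; rewrite leeD2l// lee_fin.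
(* The sets [S e] are nested, hence a filter base, and nonempty since [m] is the infimum. *)
have FF : ProperFilter (filter_from [set e : R | 0 < e] S).
  apply: filter_from_proper.
    apply: filter_from_filter; first by exists 1 => /=.
    move=> d e /= d0 e0; exists (Num.min d e); first by rewrite /= lt_min d0.
    by move=> x Sx; split; apply: S_sub Sx; rewrite ge_min lexx ?orbT.
  move=> e e0; have [_ [x _ <-] Jx] := lb_ereal_inf_adherent e0 m_fin.
  by exists x; apply: ltW.
(* [S 1] lies in a compact [K], so the filter clusters at some [x] in [K]. *)
have [K cK SK] := J_coercive (fine m + 1).
have FK : filter_from [set e : R | 0 < e] S K.
  by exists 1 => //= x Sx; apply: SK; rewrite /= EFinD fineK.
have [x [_ Fx]] := cK _ FF FK.
exists x => y; apply: (@le_trans _ _ m); last first.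
  by apply: ereal_inf_lbound; exists y.
apply/lee_addgt0Pr => e e0; have e20 : 0 < e / 2 by rewrite divr_gt0.
(* [S (e / 2)] meets the neighbourhood of [x] given by semicontinuity; the two halves add up to
   [J x <= m + e]. *)
have [|z [Sz Jxz]] := Fx (S (e / 2)) _ _ (J_lsc x _ e20).
  by exists (e / 2).
apply: le_trans Jxz _; apply: le_trans (leeD2r _ Sz) _.
by rewrite -addeA -EFinD -splitr.
Qed.

(** The product topology makes the projections continuous and gives access to Tychonoff's
    theorem. *)
Definition controls (N : nat) (U : topologicalType) : topologicalType :=
  prod_topology (fun _ : 'I_N => U).

Section cost.
Context {R : realType} {X U Theta : pmetricType R} {N : nat}.
Variables (f : X -> U -> Theta -> X) (lu : U -> R)
  (l0 l : X -> U -> Theta -> R) (FN : X -> Theta -> R).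
Hypothesis lE : forall x u theta, l x u theta = lu u + l0 x u theta.

Section measurability.
Variable xbar0 : borel Theta -> borel X.
Hypothesis xbar0_meas : measurable_fun setT xbar0.
Hypothesis l0_meas : forall u, measurable_fun setT
  (fun p : borel X * borel Theta => l0 p.1 u p.2).
Hypothesis f_meas : forall u, measurable_fun setT
  (fun p : borel X * borel Theta => f p.1 u p.2 : borel X).
Hypothesis FN_meas : measurable_fun setT
  (fun p : borel X * borel Theta => FN p.1 p.2).

Lemma measurable_traj (u : 'I_N -> U) n : measurable_fun setT
  (fun theta : borel Theta => traj f u (xbar0 theta) theta n : borel X).
Proof.
(* Before time [N], the next state is [f] at a fixed control, composed with the pairing of state and
   [theta]; from [N] on the trajectory is constant. *)
elim: n => [//|n IHn] /=; case: insubP => [i _ _|_ //].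
exact: measurableT_comp (f_meas (u i))
  (measurable_fun_pair IHn (@measurable_id _ _ setT)).
Qed.

Lemma measurable_total_cost (u : 'I_N -> U) : measurable_fun setT
  (fun theta : borel Theta => total_cost f l FN (xbar0 theta) u theta).
Proof.
have traj_id n := measurable_fun_pair (measurable_traj u n)
  (@measurable_id _ (borel Theta) setT).
apply: measurable_funD; last exact: measurableT_comp FN_meas (traj_id N).
apply: measurable_sum => n; under eq_fun do rewrite lE.
apply: measurable_funD => //.
exact: measurableT_comp (l0_meas (u n)) (traj_id n).
Qed.

End measurability.

Hypothesis f_cont : exists ax au : R -> R,
  [/\ class_Kinfty ax, class_Kinfty au & forall theta x x' u u',
    mdist (f x u theta) (f x' u' theta)
      <= ax (mdist x x') + au (mdist u u')].
Hypothesis l0_cont : exists gx gu : R -> R,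
  [/\ class_Kinfty gx, class_Kinfty gu & forall x x' u u' theta,
    `|l0 x u theta - l0 x' u' theta| <= gx (mdist x x') + gu (mdist u u')].
Hypothesis lu_lsc : lower_semicontinuous (fun u => (lu u)%:E).
Hypothesis FN_cont : exists gN : R -> R, class_Kinfty gN /\
  forall x x' theta, `|FN x theta - FN x' theta| <= gN (mdist x x').

Let near_control (u : controls N U) (i : 'I_N) (A : set U) :
  nbhs (u i) A -> \forall u' \near u, A (u' i).
Proof. exact: (@proj_continuous _ (fun _ : 'I_N => U) i u). Qed.

Let near_control_dist (u : controls N U) (i : 'I_N) (d : R) : 0 < d ->
  \forall u' \near u, mdist (u i) (u' i) < d.
Proof.
move=> d0; apply: (@near_control u i [set v | mdist (u i) v < d]).
by rewrite -ballEmdist; exact: nbhsx_ballx.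
Qed.

(** By induction on time: [f] turns the state gap and the control gap into at most [ax] plus [au] of
    them, and each is kept below [e / 2] uniformly in [x0] and [theta]. *)
Lemma near_traj (u : controls N U) n (e : R) : 0 < e ->
  \forall u' \near u, forall x0 theta,
    mdist (traj f u x0 theta n) (traj f u' x0 theta n) < e.
Proof.
elim: n e => [|n IHn] e e0.
  by near=> u' => x0 theta; rewrite mdistxx.
(* From time [N] on the trajectory stays put, so the induction hypothesis suffices. *)
case/boolP: (n < N)%N => nN; last first.
  by apply: filterS (IHn _ e0) => u' /=; rewrite insubN.
pose i := Ordinal nN.
have [ax [au [axK auK f_le]]] := f_cont.
have e20 : 0 < e / 2 by rewrite divr_gt0.
have [dx dx0 ax_lt] := class_Kinfty_small axK e20.
have [du du0 au_lt] := class_Kinfty_small auK e20.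
near=> u' => x0 theta; rewrite (trajS _ _ _ _ i) (trajS _ _ _ _ i).
apply: le_lt_trans (f_le _ _ _ _ _) _.
rewrite [ltRHS]splitr ltrD//.
  apply: ax_lt; first exact: mdist_ge0.
  by move: x0 theta; near: u'; exact: IHn.
apply: au_lt; first exact: mdist_ge0.
by near: u'; exact: near_control_dist.
Unshelve. all: by end_near. Qed.

(** The error is split in three: semicontinuity of [lu], [gx] of the trajectory gap, [gu] of the
    control gap. The bound is one-sided because [lu] is only lower semicontinuous. *)
Lemma near_stage_cost (u : controls N U) (n : 'I_N) (e : R) : 0 < e ->
  \forall u' \near u, forall x0 theta,
    l (traj f u x0 theta n) (u n) theta
      <= l (traj f u' x0 theta n) (u' n) theta + e.
Proof.
move=> e0; have e30 : 0 < e / 3 by rewrite divr_gt0.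
have [gx [gu [gxK guK l0_le]]] := l0_cont.
have [dx dx0 gx_lt] := class_Kinfty_small gxK e30.
have [du du0 gu_lt] := class_Kinfty_small guK e30.
have : ((lu (u n) - e / 3)%:E < (lu (u n))%:E)%E.
  by rewrite lte_fin ltrBlDr ltrDl.
move=> /lu_lsc[V nV luV].
near=> u' => x0 theta.
have lu_lt : lu (u n) - e / 3 < lu (u' n).
  by rewrite -lte_fin; apply: luV; near: u'; exact: near_control.
have gx_e : gx (mdist (traj f u x0 theta n) (traj f u' x0 theta n)) < e / 3.
  apply: gx_lt; first exact: mdist_ge0.
  by move: x0 theta; near: u'; exact: near_traj.
have gu_e : gu (mdist (u n) (u' n)) < e / 3.
  apply: gu_lt; first exact: mdist_ge0.
  by near: u'; exact: near_control_dist.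
have := l0_le (traj f u x0 theta n) (traj f u' x0 theta n) (u n) (u' n) theta.
move=> /(le_trans (ler_norm _)) l0_e.
by rewrite !lE; lra.
Unshelve. all: by end_near. Qed.

Lemma near_total_cost (u : controls N U) (e : R) : 0 < e ->
  \forall u' \near u, forall x0 theta,
    total_cost f l FN x0 u theta <= total_cost f l FN x0 u' theta + e.
Proof.
(* The [N] stage costs and the terminal cost share the error equally. *)
move=> e0; pose d := e / N.+1%:R.
have d0 : 0 < d by rewrite divr_gt0.
have [gN [gNK FN_le]] := FN_cont.
have [dN dN0 gN_lt] := class_Kinfty_small gNK d0.
near=> u' => x0 theta.
have stage (n : 'I_N) : l (traj f u x0 theta n) (u n) theta
    <= l (traj f u' x0 theta n) (u' n) theta + d.
  move: n x0 theta; near: u'.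
  (* There are finitely many stages, so their neighbourhoods intersect in a neighbourhood. *)
  apply: (@filter_forall _ _ (fun (n : 'I_N) (u' : controls N U) =>
    forall x0 theta, l (traj f u x0 theta n) (u n) theta
      <= l (traj f u' x0 theta n) (u' n) theta + d)) => n.
  exact: near_stage_cost.
have terminal : FN (traj f u x0 theta N) theta
    <= FN (traj f u' x0 theta N) theta + d.
  rewrite -lerBlDl; apply: le_trans (ler_norm _) _.
  apply: le_trans (FN_le _ _ _) _; apply/ltW/gN_lt; first exact: mdist_ge0.
  by clear stage; move: x0 theta; near: u'; exact: near_traj.
have -> : e = d *+ N + d by rewrite -mulrSr -mulr_natr divfK.
rewrite /total_cost addrACA lerD//.
apply: le_trans (ler_sum _ (fun n _ => stage n)) _.
by rewrite big_split/= sumr_const card_ord.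
Unshelve. all: by end_near. Qed.

End cost.

Theorem theorem6 (R : realType) (X U Theta : pmetricType R) (N : nat)
    (N_ge1 : (1 <= N)%N)
    (f : X -> U -> Theta -> X)
    (lu : U -> R) (l0 l : X -> U -> Theta -> R) (FN : X -> Theta -> R)
    (lu_ge0 : forall u, 0 <= lu u)
    (l0_ge0 : forall x u theta, 0 <= l0 x u theta)
    (FN_ge0 : forall x theta, 0 <= FN x theta)
    (lE : forall x u theta, l x u theta = lu u + l0 x u theta)
    (f_cont : exists ax au : R -> R, [/\ class_Kinfty ax, class_Kinfty au &
      forall theta x x' u u',
        mdist (f x u theta) (f x' u' theta)
          <= ax (mdist x x') + au (mdist u u')])
    (l0_cont : exists gx gu : R -> R, [/\ class_Kinfty gx, class_Kinfty gu &
      forall x x' u u' theta,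
        `|l0 x u theta - l0 x' u' theta|
          <= gx (mdist x x') + gu (mdist u u')])
    (lu_lsc : lower_semicontinuous (fun u => (lu u)%:E))
    (FN_cont : exists gN : R -> R, class_Kinfty gN /\
      forall x x' theta, `|FN x theta - FN x' theta| <= gN (mdist x x'))
    (l0_meas : forall u, measurable_fun setT
      (fun p : borel X * borel Theta => l0 p.1 u p.2))
    (f_meas : forall u, measurable_fun setT
      (fun p : borel X * borel Theta => f p.1 u p.2 : borel X))
    (FN_meas : measurable_fun setT
      (fun p : borel X * borel Theta => FN p.1 p.2))
    (l_coercive : exists r : U -> R,
      [/\ forall u, 0 <= r u, coercive (fun u => (r u)%:E) &
        forall x u theta, r u <= l x u theta]) :
  forall (mu : probability (borel Theta) R) (xbar0 : borel Theta -> borel X),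
    measurable_fun setT xbar0 ->
    (forall u : 'I_N -> U, measurable_fun setT
      (fun theta : borel Theta => total_cost f l FN (xbar0 theta) u theta)) /\
    exists ustar : 'I_N -> U,
      averaged_cost f l FN xbar0 ustar mu
        = value_function N f l FN xbar0 mu /\
      forall u : 'I_N -> U,
        (averaged_cost f l FN xbar0 ustar mu
          <= averaged_cost f l FN xbar0 u mu)%E.
Proof.
move=> mu xbar0 xbar0_meas.
have cost_meas (u : 'I_N -> U) := measurable_total_cost lE xbar0_meas
  l0_meas f_meas FN_meas u.
split => //.
have l_ge0 x u theta : 0 <= l x u theta by rewrite lE addr_ge0.
have cost_ge0 x u theta : 0 <= @total_cost _ _ _ _ N f l FN x u theta.
  by rewrite addr_ge0// sumr_ge0.
have mEFin (u : 'I_N -> U) : measurable_fun setT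
    (fun theta : borel Theta => (total_cost f l FN (xbar0 theta) u theta)%:E).
  exact/measurable_EFinP.
(* Total mass 1 serves twice: for the error [e] and for the lower bound [r (u i)]. *)
have int_cst (t : R) : (\int[mu]_theta (cst t%:E theta) = t%:E)%E.
  by rewrite integral_cst// [X in (_ * X)%E](probability_setT mu) mule1.
have [] := @lower_semicontinuous_min R (controls N U) (fun=> point)
  (fun u => averaged_cost f l FN xbar0 u mu).
- by move=> u; apply: integral_ge0 => theta _; rewrite lee_fin.
- move=> u e e0.
  have := near_total_cost lE f_cont l0_cont lu_lsc FN_cont u e0.
  apply: filterS => u' u_le; rewrite -[e%:E]int_cst -ge0_integralD//.
  + apply: ge0_le_integral => //.
    * by move=> theta _; rewrite lee_fin.
    * exact: emeasurable_funD (mEFin u') (measurable_cst e%:E).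
    * by move=> theta _; rewrite -EFinD lee_fin.
  + by move=> theta _; rewrite lee_fin.
  + by move=> theta _; rewrite lee_fin ltW.
- move=> t; have [r [r_ge0 r_coercive r_le]] := l_coercive.
  (* Coercivity concerns strict sublevel sets, so the bound [r (u i) <= t] is used at level
     [t + 1]. *)
  exists [set u : controls N U |
      forall i, closure [set v | ((r v)%:E < (t + 1)%:E)%E] (u i)].
    move/coerciveE : r_coercive => /(_ (t + 1)) r_compact.
    exact: (@tychonoff _ (fun _ : 'I_N => U) _ (fun=> r_compact)).
  move=> u /= u_le i; apply: subset_closure => /=.
  apply: (@le_lt_trans _ _ t%:E); last by rewrite lte_fin ltrDl.
  apply: le_trans u_le; rewrite -[(r (u i))%:E]int_cst.
  apply: ge0_le_integral => //; first by move=> theta _; rewrite lee_fin.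
  (* The [i]-th stage cost alone dominates [r (u i)]; all other terms are nonnegative. *)
  move=> theta _; rewrite lee_fin /total_cost (bigD1 i)//= -addrA.
  apply: le_trans (r_le (traj f u (xbar0 theta) theta i) (u i) theta) _.
  by rewrite lerDl addr_ge0// sumr_ge0.
move=> ustar ustar_min; exists ustar; split=> //.
apply/eqP; rewrite eq_le; apply/andP; split.
  by apply: le_ereal_inf_tmp => _ [u _ <-].
by apply: ereal_inf_lbound; exists ustar.
Qed.
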